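(* Let $G$ be a finite group and let $N$ be a normal subgroup of $G$. Then for every integer $n\ge 0$, $P_2(G,n)\leq P_2(G/N,n)\,P_2(N,n)$, and therefore, for every integer $n\ge 1$, $$k_n(G)\leq k_n(G/N)\,k_n(N).$$
   Context: For a finite group $K$ and an integer $n\ge 0$, $P_2(K,n)=|\mathrm{Hom}(\mathbb{Z}^n,K)|/|K|^n$, where $\mathrm{Hom}(\mathbb{Z}^n,K)$ is identified with the set of ordered $n$-tuples of pairwise commuting elements of $K$. For $n\ge 1$, $k_n(K)=|\mathrm{Hom}(\mathbb{Z}^n,K)/K|$ is the number of orbits of ordered commuting $n$-tuples in $K$ under simultaneous conjugation by $K$. *)

(* Defs.v *)
From mathcomp Require Import all_boot all_order all_algebra all_fingroup.

Set Implicit Arguments.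
Unset Strict Implicit.
Unset Printing Implicit Defensive.

Import GroupScope GRing.Theory Num.Theory.

Section CommutingTuples.

Variable gT : finGroupType.
Implicit Types (K : {group gT}) (n : nat).

(* Hom(Z^n, K): a homomorphism is recorded by the images of the n standard
   basis vectors of Z^n, which may be any pairwise commuting elements of K. *)
Definition commuting_tuples K n : {set n.-tuple gT} :=
  [set t : n.-tuple gT |
     [forall i, tnth t i \in K] &&
     [forall i, forall j, tnth t i * tnth t j == tnth t j * tnth t i]].

Definition conj_tuple n (t : n.-tuple gT) (x : gT) : n.-tuple gT :=
  [tuple tnth t i ^ x | i < n].

Fact conj_tuple_is_action n : is_action [set: gT] (@conj_tuple n).
Proof.
apply: is_total_action => [t | t x y]; apply: eq_from_tnth => i.
  by rewrite tnth_mktuple conjg1.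
by rewrite !tnth_mktuple conjgM.
Qed.

Canonical conj_tuple_action n := Action (@conj_tuple_is_action n).

Definition P2 K n : rat :=
  (#|commuting_tuples K n|%:R / #|K|%:R ^+ n)%R.

(* k_n(K) = |Hom(Z^n, K) / K| *)
Definition num_conj_orbits K n : nat :=
  #|orbit (conj_tuple_action n) K @: commuting_tuples K n|.

End CommutingTuples.

(* Main.v *)
Require Import Defs.
From mathcomp Require Import all_boot all_order all_algebra all_fingroup.
Import GroupScope GRing.Theory Num.Theory.

(** Write c_n(K) for the number of commuting n-tuples of K. Since
    #|G| = #|G / N| * #|N|, the inequality on P2 says that
    c_n(G) <= c_n(G / N) * c_n(N). Reduction modulo N sends commuting tuples of
    G to commuting tuples of G / N, so it suffices to bound each fibre, i.e. the
    number of commuting tuples in a product N x_1, ..., N x_n of cosets, by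
    c_n(N). This is done by replacing the cosets by N one at a time: once the
    other coordinates are fixed, the admissible values of the i-th one form the
    intersection of N x_i with the centraliser of these coordinates, which is
    either empty or a coset of the centraliser in N. Replacing N x_i by N hence
    cannot decrease the count (leq_card_commuting_replace).

    The inequality on orbits follows: counting the pairs made of an element of
    K and a commuting n-tuple that it fixes, as in Burnside's lemma, gives
    k_n(K) * #|K| = c_(n+1)(K) for the number k_n(K) of conjugation orbits
    (num_conj_orbitsM), and the previous bound applies to c_(n+1). *)

Section CommutingTuplesInProduct.

Variable gT : finGroupType.
Implicit Types (K N : {group gT}) (n : nat).

(** Allowing a different constraint on each coordinate is what makes it
    possible to interpolate between a product of cosets and a power of N. *)
Definition commuting_in n (A : 'I_n -> {set gT}) : {set n.-tuple gT} :=
  [set t : n.-tuple gT |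
     [forall i, tnth t i \in A i] &&
     [forall i, forall j, tnth t i * tnth t j == tnth t j * tnth t i]].

Lemma commuting_inP n (A : 'I_n -> {set gT}) (t : n.-tuple gT) :
  reflect ((forall i, tnth t i \in A i) /\
           (forall i j, commute (tnth t i) (tnth t j)))
          (t \in commuting_in n A).
Proof.
rewrite inE; apply: (iffP andP) => -[tA tC]; split.
- exact/forallP.
- by move=> i j; move/forallP/(_ i)/forallP/(_ j)/eqP: tC.
- exact/forallP.
- by apply/forallP=> i; apply/forallP=> j; apply/eqP/tC.
Qed.

Lemma commuting_tuplesE K n : commuting_tuples K n = commuting_in n (fun=> K).
Proof. by []. Qed.

Lemma eq_commuting_in n (A B : 'I_n -> {set gT}) :
  A =1 B -> commuting_in n A = commuting_in n B.
Proof.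
move=> eqAB; apply/setP=> t.
by apply/commuting_inP/commuting_inP=> -[tA tC]; split=> // i;
  rewrite ?eqAB // -eqAB.
Qed.

(** The injection divides the i-th coordinate by a representative of the set
    of its admissible values, a set that only depends on the other
    coordinates; the original tuple can therefore be recovered. *)
Lemma leq_card_commuting_replace n (A B : 'I_n -> {set gT}) (i : 'I_n) N x :
    A i = N :* x -> B i = N -> (forall j, j != i -> B j = A j) ->
  #|commuting_in n A| <= #|commuting_in n B|.
Proof.
move=> Ai Bi Bj.
pose r (t : n.-tuple gT) :=
  repr (A i :&: 'C([set tnth t j | j : 'I_n & j != i])).
have rP t : t \in commuting_in n A ->
    r t \in A i /\ forall j, j != i -> commute (tnth t j) (r t).
  case/commuting_inP=> tA tC.
  have /mem_repr : tnth t i \in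
      A i :&: 'C([set tnth t j | j : 'I_n & j != i]).
    rewrite inE tA; apply/centP=> _ /imsetP[j _ ->]; exact: tC.
  rewrite -/(r t) inE => /andP[-> /centP rC]; split=> // j ji.
  by apply/commute_sym/rC/imsetP; exists j; rewrite ?inE.
pose f (t : n.-tuple gT) :=
  [tuple if j == i then tnth t j * (r t)^-1 else tnth t j | j < n].
have fi t : tnth (f t) i = tnth t i * (r t)^-1 by rewrite tnth_mktuple eqxx.
have fj t j : j != i -> tnth (f t) j = tnth t j.
  by rewrite tnth_mktuple => /negbTE->.
have injf : {in commuting_in n A &, injective f}.
  move=> t u _ _ eqf.
  have eqj j : j != i -> tnth t j = tnth u j by move=> ji; rewrite -(fj t) // eqf fj.
  have eqr : r t = r u.
    by congr (repr (_ :&: 'C(_))); apply: eq_in_imset => j; rewrite inE => /eqj.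
  apply: eq_from_tnth => j; have [->|/eqj//] := eqVneq j i.
  by apply: (mulIg (r t)^-1); rewrite {2}eqr -!fi eqf.
rewrite -(card_in_imset injf); apply/subset_leq_card/subsetP=> _ /imsetP[t tA ->].
(* Both t_i and r t lie in N :* x and commute with the other coordinates, so
   their quotient lies in N and commutes with the other coordinates. *)
have [rA rC] := rP _ tA; case/commuting_inP: tA => tA tC.
have fC j : j != i -> commute (tnth (f t) j) (tnth (f t) i).
  move=> ji; rewrite fi fj //; apply: commuteM => //.
  exact/commuteV/rC.
apply/commuting_inP; split=> [j|j k].
  have [->|ji] := eqVneq j i; last by rewrite fj // Bj.
  have := tA i; rewrite fi Bi; move: rA; rewrite Ai.
  case/rcosetP=> y Ny -> /rcosetP[z Nz ->].
  by rewrite invMg mulgA mulgK groupM ?groupV.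
have [->|ji] := eqVneq j i; have [->|ki] := eqVneq k i => //.
- exact/commute_sym/fC.
- exact: fC.
- by rewrite !fj.
Qed.

(** The cosets are replaced by N from left to right: A k has N in its first k
    coordinates, and going from A k to A k.+1 does not lower the count. *)
Lemma leq_card_commuting_cosets n N (x : 'I_n -> gT) :
  #|commuting_in n (fun i => N :* x i)| <= #|commuting_tuples N n|.
Proof.
pose A k (i : 'I_n) : {set gT} := if i < k then N : {set gT} else N :* x i.
have leA k : k <= n ->
    #|commuting_in n (fun i => N :* x i)| <= #|commuting_in n (A k)|.
  elim: k => [_ | k IHk ltkn]; first by rewrite leq_eqVlt eqxx.
  apply: leq_trans (IHk (ltnW ltkn)) _.
  apply: (@leq_card_commuting_replace _ _ _ (Ordinal ltkn) N (x (Ordinal ltkn))).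
  - by rewrite /A ltnn.
  - by rewrite /A leqnn.
  - by move=> j jk; rewrite /A ltnS leq_eqVlt (negbTE (jk : (j : nat) != k)).
apply: leq_trans (leA n (leqnn n)) _.
rewrite commuting_tuplesE (@eq_commuting_in n (A n) (fun=> N)) // => i.
by rewrite /A ltn_ord.
Qed.

End CommutingTuplesInProduct.

(** The number of fibres of reduction modulo N is at most the first factor, and
    leq_card_commuting_cosets bounds the size of each fibre by the second. *)
Lemma leq_card_commuting_quotient (gT : finGroupType) (G N : {group gT}) n :
    N <| G ->
  #|commuting_tuples G n| <=
    #|commuting_tuples (G / N)%G n| * #|commuting_tuples N n|.
Proof.
move=> nNG; have nG := subsetP (normal_norm nNG).
pose q (t : n.-tuple gT) := map_tuple (coset N) t.
rewrite -sum1_card (partition_big q (mem (commuting_tuples (G / N)%G n))) /=.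
  rewrite -sum_nat_const; apply: leq_sum => u _; rewrite sum1_card.
  (* The fibre over u lies in the product of the cosets tnth u i, each viewed
     as the right coset of any of its elements. *)
  apply: leq_trans (leq_card_commuting_cosets _ _ _ (fun i => repr (tnth u i))).
  apply/subset_leq_card/subsetP=> t /andP[/commuting_inP[tG tC] /eqP <-].
  apply/commuting_inP; split=> // i; rewrite tnth_map.
  by rewrite rcoset_sym val_coset ?nG // mem_repr_rcoset.
move=> t /commuting_inP[tG tC]; apply/commuting_inP; split=> [i|i j].
  by rewrite tnth_map mem_quotient.
by rewrite /commute !tnth_map -!morphM ?nG // tC.
Qed.

(** The fixed points of a in K are the commuting n-tuples that stay commuting
    when a is prepended, so Burnside's formula counts commuting n.+1-tuples. *)
Lemma num_conj_orbitsM (gT : finGroupType) (K : {group gT}) n :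
  (num_conj_orbits K n * #|K|)%N = #|commuting_tuples K n.+1|.
Proof.
have actsK : [acts K, on commuting_tuples K n | conj_tuple_action gT n].
  apply/actsP=> a Ka t /=.
  have conjK b u : b \in K -> u \in commuting_tuples K n ->
      conj_tuple u b \in commuting_tuples K n.
    move=> Kb /commuting_inP[uK uC]; apply/commuting_inP.
    split=> [i|i j]; rewrite !tnth_mktuple ?groupJ //.
    by rewrite /commute -!conjMg uC.
  apply/idP/idP=> [|tK]; last exact: conjK.
  move/(conjK a^-1); rewrite groupV => /(_ Ka).
  by rewrite (actK (conj_tuple_action gT n) a t).
rewrite /num_conj_orbits -(Frobenius_Cauchy actsK) -sum1_card.
rewrite (partition_big (fun t : n.+1.-tuple gT => thead t) (mem K)) /=; last first.
  by move=> t /commuting_inP[tK _]; apply: tK.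
apply: eq_bigr => a Ka; rewrite sum1_card.
have inj_cons : injective (fun t : n.-tuple gT => [tuple of a :: t]).
  by move=> t u /(congr1 val)[] /val_inj.
rewrite -(card_imset _ inj_cons); apply: eq_card => t; rewrite [RHS]unfold_in /=.
apply/imsetP/andP=> [[u] | [/commuting_inP[tK tC] /eqP ta]].
  rewrite inE => /andP[/commuting_inP[uK uC] /afix1P/= fix_u] ->; split=> //.
  have au i : commute a (tnth u i).
    by apply/commute_sym/commgP/conjg_fixP; rewrite -[in RHS]fix_u tnth_mktuple.
  apply/commuting_inP; split=> [i|i j].
    by case: (unliftP ord0 i) => [k|] ->; rewrite ?tnth0 ?tnthS.
  case: (unliftP ord0 i) (unliftP ord0 j) => [k|] -> [l|] ->;
    rewrite ?tnth0 ?tnthS //; exact/commute_sym.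
case/tupleP: t => b v in tK tC ta *; rewrite theadE in ta; subst b.
exists v => //; rewrite inE; apply/andP; split.
  apply/commuting_inP; split=> [i|i j]; first by have:= tK (lift ord0 i); rewrite tnthS.
  by have:= tC (lift ord0 i) (lift ord0 j); rewrite !tnthS.
apply/afix1P; apply: eq_from_tnth => i /=; rewrite tnth_mktuple.
by apply/conjg_fixP/commgP; have:= tC (lift ord0 i) ord0; rewrite tnthS tnth0.
Qed.

Theorem proposition6p3 (gT : finGroupType) (G N : {group gT}) (nNG : N <| G) :
  (forall n : nat, (P2 G n <= P2 (G / N)%G n * P2 N n)%R) /\
  (forall n : nat, (1 <= n)%N ->
     (num_conj_orbits G n <=
        num_conj_orbits (G / N)%G n * num_conj_orbits N n)%N).
Proof.
have cardG : #|G| = (#|(G / N)%G| * #|N|)%N.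
  by rewrite card_quotient ?normal_norm // mulnC Lagrange ?normal_sub.
split=> n.
  rewrite /P2 mulf_div -exprMn -natrM -natrM -cardG.
  rewrite ler_wpM2r ?invr_ge0 ?exprn_ge0 ?ler0n // ler_nat.
  exact: leq_card_commuting_quotient.
move=> _; rewrite -(leq_pmul2r (cardG_gt0 G)) {2}cardG mulnACA.
rewrite !num_conj_orbitsM; exact: leq_card_commuting_quotient.
Qed.
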